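(* Let $k\ge 2$ and let $S$ be a curve consisting of $k$ rational components $S_1,\dots,S_k$ with intersection data $a_{ij}\in\mathbb{C}$ ($i\neq j$) as described in the context. The extended theta function $\vartheta:(\mathbb{C}^*\times\mathbb{C}^* )^{k(k-1)}\to\mathbb{C}$ of $S$, $\vartheta(\lambda_{ij},\mu_{ij})=\det\Xi$, is given by $$\vartheta(\lambda_{ij},\mu_{ij})=\sum_{L\in\mathcal{R}(P)}a_L\prod_{(i,j)\in L}\lambda_{ij}\prod_{(i,j)\notin L}\mu_{ij},$$ where the sum is over all regular subsets $L$ of $P=\{(i,j):1\le i,j\le k,\ i\ne j\}$, and each coefficient is $$a_L=(-1)^s\prod_{m=1}^kV(L_m).$$ Here $L_m=\{(m,j)\in L\}\cup\{(n,m)\in P:(n,m)\notin L\}$, $V(L_m)$ is the Vandermonde determinant of the numbers $\{a_{ij}:(i,j)\in L_m\}$ for some chosen ordering of $L_m$, and $(-1)^s$ is the sign of the permutation of $P$ defined by the ordered list $(L_1,\dots,L_k)$ (relative to the lexicographic order of $P$), where each $L_m$ is ordered as in the definition of $V(L_m)$.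
   Context: The curve: $S$ is a union of $k$ copies $S_1,\dots,S_k$ of $\mathbb{P}^1$ with a map $\pi:S\to\mathbb{P}^1$ restricting to an isomorphism on each $S_i$; each pair $S_i,S_j$ ($i\ne j$) meets in exactly two points, all intersection points are distinct and are ordinary double points. For $i\ne j$ the images under $\pi$ of the two points of $S_i\cap S_j$ are denoted $a_{ij},a_{ji}$, and all are assumed to be different from $\infty$. (The images of distinct intersection points lying on the same component are distinct.) The matrix $\Xi$: for $(\lambda_{ij},\mu_{ij})_{(i,j)\in P}$ consider polynomials $Q_1,\dots,Q_k$ of degree at most $k-2$ and the $k(k-1)$ linear equations $$\lambda_{ij}Q_i(a_{ij})+\mu_{ij}Q_j(a_{ij})=0,\qquad (i,j)\in P,$$ in the coefficients of the $Q_m$. $\Xi$ is the $k(k-1)\times k(k-1)$ matrix of the left-hand side: rows are labelled by $(i,j)\in P$ in lexicographic order, columns by $(m,n)$, $m=1,\dots,k$, $n=0,\dots,k-2$, in lexicographic order, where $(m,n)$ corresponds to the coefficient of $\zeta^n$ in $Q_m(\zeta)$. So the entry in row $(i,j)$ and column $(m,n)$ is $\lambda_{ij}a_{ij}^n$ if $m=i$, $\mu_{ij}a_{ij}^n$ if $m=j$, and $0$ otherwise. Regular subsets: $L\subset P$ is regular if for every $i$ the number of elements of $L$ with first coordinate $i$ equals the number of elements of $L$ with second coordinate $i$; equivalently, each $L_i$ defined in the claim has cardinality $k-1$. $\mathcal{R}(P)$ is the set of regular subsets of $P$. The Vandermonde determinant of an ordered list $(y_1,\dots,y_{k-1})$ is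 $\det[y_r^{n}]_{r=1,\dots,k-1;\ n=0,\dots,k-2}$. *)

(* Defs.v *)
From HB Require Import structures.
From mathcomp Require Import all_boot all_order all_algebra all_fingroup.
From mathcomp Require Import reals complex.

Set Implicit Arguments.
Unset Strict Implicit.
Unset Printing Implicit Defensive.

Import GRing.Theory.
Local Open Scope ring_scope.

(* Closed points of a union of k copies S_i of P^1 over a map [proj] to P^1.
   P^1(C) is [option C], with [None] the point at infinity, and [branch i] is
   the inverse of the restriction of [proj] to S_i. Two components can only
   meet above the same point of P^1, so the points of S_i and S_j in common
   are the [branch i z] with [branch i z = branch j z]. The scheme structure at
   the nodes is not recorded: an ordinary double point at which both branches
   are sections of [proj] is determined by the two points being glued. *)
Record rational_curve (C : fieldType) (k : nat) := RationalCurve {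
  point : Type;
  proj : point -> option C;
  branch : 'I_k -> option C -> point;
  (* a_ij; the diagonal values are unused *)
  node : 'I_k -> 'I_k -> C;
  branchK : forall i, cancel (branch i) proj;
  branch_cover : forall x, exists i, branch i (proj x) = x;
  branch_meet : forall i j, i != j -> forall z,
    branch i z = branch j z <-> z = Some (node i j) \/ z = Some (node j i);
  node_neq : forall i j, i != j -> node i j <> node j i;
  (* intersection points of different pairs of components are distinct *)
  no_triple_point : forall i j l z, i != j -> j != l -> i != l ->
    ~ (branch i z = branch j z /\ branch j z = branch l z)
}.

Definition pairs (k : nat) := {p : 'I_k * 'I_k | p.1 != p.2}.

Definition src k (p : pairs k) : 'I_k := (val p).1.
Definition tgt k (p : pairs k) : 'I_k := (val p).2.

Definition anode (C : fieldType) k (S : rational_curve C k) (p : pairs k) : C :=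
  node S (src p) (tgt p).

Lemma anode_inj (C : fieldType) k (S : rational_curve C k) (i : 'I_k)
    (p q : pairs k) :
  (src p == i) || (tgt p == i) -> (src q == i) || (tgt q == i) ->
  anode S p = anode S q -> p = q.
Proof.
have meet j : i != j -> forall z, z = node S i j \/ z = node S j i ->
    branch S i (Some z) = branch S j (Some z).
  by move=> ij z zE; apply/(branch_meet S ij); case: zE => ->; [left|right].
have other (r : pairs k) : (src r == i) || (tgt r == i) ->
    exists j, [/\ i != j, anode S r = node S i j \/ anode S r = node S j i &
      val r = (i, j) \/ val r = (j, i)].
  case: r => -[u v] /= uv; rewrite /anode /src /tgt /= => /orP[]/eqP <-.
    by exists v; split=> //; left.
  by exists u; split; [rewrite eq_sym|right|right].
move=> /other[j [ij pE vp]] /other[l [il qE vq]] pq; apply: val_inj.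
have [jl|jl] := eqVneq j l; last first.
  have e1 := meet _ ij _ pE; have e2 := meet _ il _ qE.
  case: (@no_triple_point _ _ S i j l (Some (anode S p)) ij jl il).
  by split=> //; rewrite -e1 pq.
subst l; have ne := @node_neq _ _ S i j ij.
by case: vp vq pq => vp [] vq; rewrite vp vq // /anode /src /tgt vp vq /= => /esym;
  [move/esym/ne|move/ne].
Qed.

Section Lexicographic.
Variable k : nat.
Implicit Type r : 'I_(k * k.-1).

Fact lex_pred_gt0 r : (0 < k.-1)%N.
Proof. by have := leq_ltn_trans (leq0n r) (ltn_ord r); rewrite muln_gt0 => /andP[]. Qed.

Fact lex_quo_subproof r : (r %/ k.-1 < k)%N.
Proof. by rewrite ltn_divLR ?(lex_pred_gt0 r). Qed.

Fact lex_rem_subproof r : (r %% k.-1 < k.-1)%N.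
Proof. by rewrite ltn_pmod ?(lex_pred_gt0 r). Qed.

(* The r-th pair (m, n), in lexicographic order, with m < k and n < k - 1. *)
Definition lex_col r : 'I_k * 'I_k.-1 :=
  (Ordinal (lex_quo_subproof r), Ordinal (lex_rem_subproof r)).

(* The r-th element of P in lexicographic order: [lift i] is the increasing
   enumeration of the indices different from i. *)
Definition lex_row r : pairs k :=
  exist _ ((lex_col r).1, lift (lex_col r).1 (lex_col r).2) (neq_lift _ _).

Definition lex_pairs : seq (pairs k) := [seq lex_row r | r <- enum 'I_(k * k.-1)].

Lemma lex_row_lt (r s : 'I_(k * k.-1)) : (r < s)%N ->
  (src (lex_row r) < src (lex_row s))%N \/
  src (lex_row r) = src (lex_row s) /\ (tgt (lex_row r) < tgt (lex_row s))%N.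
Proof.
move=> rs; rewrite /src /tgt /=.
have [lt|ge] := ltnP (r %/ k.-1) (s %/ k.-1); [by left|right].
have eq : (r %/ k.-1 = s %/ k.-1)%N.
  by apply/eqP; rewrite eqn_leq ge leq_div2r // ltnW.
split; first exact: val_inj.
rewrite eq ltnNge leq_bump2 -ltnNge.
by move: rs; rewrite {1}(divn_eq r k.-1) {1}(divn_eq s k.-1) eq ltn_add2l.
Qed.

Lemma lex_row_inj : injective lex_row.
Proof.
move=> r s e; apply: val_inj; case: (ltngtP r s) => // /lex_row_lt;
by rewrite e !ltnn => -[|[]].
Qed.

Lemma lex_row_surj (p : pairs k) : exists r, lex_row r = p.
Proof.
case: p => -[i j] /= ij; have [j' jE _] := unlift_some ij.
have kp : (0 < k.-1)%N by apply: leq_ltn_trans (ltn_ord j').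
have rP : (i * k.-1 + j' < k * k.-1)%N.
  by apply: leq_trans (_ : (i.+1 * k.-1 <= _)%N);
    rewrite ?leq_mul2r ?ltn_ord ?orbT // mulSn addnC ltn_add2r.
exists (Ordinal rP); apply: val_inj.
have eq1 : (lex_col (Ordinal rP)).1 = i.
  by apply: val_inj; rewrite /= divnMDl // divn_small ?addn0.
have eq2 : (lex_col (Ordinal rP)).2 = j'.
  by apply: val_inj; rewrite /= modnMDl modn_small.
by rewrite [LHS](_ : _ = ((lex_col (Ordinal rP)).1,
  lift (lex_col (Ordinal rP)).1 (lex_col (Ordinal rP)).2)) // eq1 eq2 -jE.
Qed.

Lemma lex_pairs_uniq : uniq lex_pairs.
Proof. by rewrite map_inj_uniq ?enum_uniq //; exact: lex_row_inj. Qed.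

Lemma perm_lex_pairs : perm_eq lex_pairs (enum {: pairs k}).
Proof.
apply: uniq_perm; rewrite ?lex_pairs_uniq ?enum_uniq // => p.
by have [r <-] := lex_row_surj p; rewrite mem_enum map_f ?mem_enum.
Qed.

Lemma card_pairs : #|{: pairs k}| = (k * k.-1)%N.
Proof. by rewrite cardE -(perm_size perm_lex_pairs) size_map size_enum_ord. Qed.

(* The permutation of P defined by an ordered list s of all its elements: it
   sends the r-th element of P to the r-th element of s (lemma [list_permE]).
   The value is 1 when s is not such a list. *)
Definition list_perm (s : seq (pairs k)) : {perm pairs k} :=
  insubd (1%g : {perm pairs k}) [ffun p => nth p s (index p lex_pairs)].

Lemma list_permE (s : seq (pairs k)) : perm_eq s (enum {: pairs k}) ->
  forall r, list_perm s (lex_row r) = nth (lex_row r) s r.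
Proof.
move=> sP r; have szs : size s = size lex_pairs.
  by rewrite (perm_size sP) (perm_size perm_lex_pairs).
have us : uniq s by rewrite (perm_uniq sP) enum_uniq.
have memP p : p \in lex_pairs by rewrite (perm_mem perm_lex_pairs) mem_enum.
have lexP p : (index p lex_pairs < size s)%N by rewrite szs index_mem.
have inj : injectiveb [ffun p => nth p s (index p lex_pairs)].
  apply/injectiveP => p q; rewrite !ffunE (set_nth_default p q) // => /eqP.
  by rewrite nth_uniq // => /eqP /index_inj; apply.
rewrite -(pvalE (list_perm s)) insubdK // ffunE index_map; last exact: lex_row_inj.
by rewrite index_enum_ord.
Qed.

End Lexicographic.

Section ExtendedTheta.
Variables (C : fieldType) (k : nat) (S : rational_curve C k).
Implicit Types (lam mu : pairs k -> C) (L : {set pairs k}).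

Definition Xi lam mu : 'M[C]_(k * k.-1) :=
  \matrix_(r, c)
    let p := lex_row r in
    let: (m, n) := lex_col c in
    if m == src p then lam p * anode S p ^+ n
    else if m == tgt p then mu p * anode S p ^+ n
    else 0.

Definition ext_theta lam mu : C := \det (Xi lam mu).

Definition regular L : bool :=
  [forall i, #|[set p in L | src p == i]| == #|[set p in L | tgt p == i]|].

(* The set L_m. *)
Definition block L (m : 'I_k) : {set pairs k} :=
  [set p in L | src p == m] :|: [set p in ~: L | tgt p == m].

Definition is_ordering (A : {set pairs k}) (s : seq (pairs k)) : Prop :=
  uniq s /\ s =i A.

(* MathComp's [Vandermonde] has the powers of one number in each column. *)
Definition vandermonde_det (s : seq (pairs k)) : C :=
  \det (Vandermonde k.-1 (\row_(r < k.-1) (map (anode S) s)`_r))^T.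

(* The coefficient a_L, for the ordering [o m] of each L_m. *)
Definition theta_coef (o : 'I_k -> seq (pairs k)) : C :=
  (-1) ^+ odd_perm (list_perm (flatten [seq o m | m <- enum 'I_k])) *
  \prod_(m < k) vandermonde_det (o m).

End ExtendedTheta.

(* Main.v *)
(** Each row of Xi is [lam p] times a row supported in the columns of colour
[src p] plus [mu p] times a row supported in the columns of colour [tgt p], so
the determinant expands by multilinearity over the sets L of rows for which the
first summand is chosen. In the term of L, the rows of colour m are those of
L_m. If some L_m does not have k - 1 elements, the term vanishes; otherwise,
listing the rows as (L_1, ..., L_k) makes the matrix block diagonal with
Vandermonde blocks. *)

Require Import Defs.
From mathcomp Require Import all_boot all_order all_algebra all_fingroup.
From mathcomp Require Import reals complex.

Set Implicit Arguments.
Unset Strict Implicit.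
Unset Printing Implicit Defensive.

Import GRing.Theory.
Local Open Scope ring_scope.

(** Carrying the transpositions of a factorisation of [s] along [f] factors [s'] into equally many.
    This links signs on [pairs k] to signs on row indices. *)
Lemma odd_perm_conj (T T' : finType) (f : T -> T') (s : {perm T})
    (s' : {perm T'}) :
  bijective f -> (forall x, f (s x) = s' (f x)) -> odd_perm s = odd_perm s'.
Proof.
move=> [g fK gK] fs; have f_inj := can_inj fK.
have [ts sE dts] := prod_tpermP s.
rewrite sE odd_perm_prod //.
pose ts' := [seq (f t.1, f t.2) | t <- ts].
have dts' : all dpair ts'.
  rewrite all_map; apply: sub_all dts => t /=.
  by rewrite /dpair /= (inj_eq f_inj).
suff -> : s' = (\prod_(t <- ts') tperm t.1 t.2)%g.
  by rewrite odd_perm_prod // size_map.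
apply/permP=> y; rewrite -(gK y) -fs sE {fs sE s s' dts dts'} /ts'.
elim: ts (g y) => [|t ts IHts] x; first by rewrite !big_nil !perm1.
by rewrite /= !big_cons !permM -(inj_tperm _ _ _ f_inj) IHts.
Qed.

(** Distributivity in the Leibniz formula: [L] is the set of rows whose factor comes from [A]. *)
Lemma det_addmx (C : comPzRingType) n (A B : 'M[C]_n) :
  \det (A + B) = \sum_(L : {set 'I_n})
    \det (\matrix_(r, c) if r \in L then A r c else B r c).
Proof.
rewrite /determinant exchange_big; apply: eq_bigr => s _ /=.
rewrite -mulr_sumr; congr (_ * _).
under eq_bigr => r _ do rewrite mxE.
rewrite bigA_distr; apply: eq_bigr => L _.
by apply: eq_bigr => r _; rewrite mxE.
Qed.

Lemma det_scale_rows (C : comPzRingType) n (d : 'I_n -> C) (A : 'M[C]_n) :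
  \det (\matrix_(r, c) (d r * A r c)) = \prod_r d r * \det A.
Proof.
rewrite /determinant mulr_sumr; apply: eq_bigr => s _.
under eq_bigr => r _ do rewrite mxE.
by rewrite big_split mulrCA.
Qed.

(** Induction on [k], splitting off the first block. Since [B] takes natural numbers, shifting the
    block index needs no casts. *)
Lemma det_block_diag (C : comPzRingType) (k n : nat)
    (B : nat -> nat -> nat -> C) :
  \det (\matrix_(r < k * n, c < k * n)
    if (r %/ n == c %/ n)%N then B (r %/ n)%N (r %% n)%N (c %% n)%N else 0) =
  \prod_(m < k) \det (\matrix_(i < n, j < n) B m i j).
Proof.
have [->|n_gt0] := posnP n.
  (* ['I_(k * 0)] is empty but not convertible to ['I_0], so the Leibniz sum is evaluated directly:
     only the identity occurs. *)
  have no_row (r : 'I_(k * 0)) : False.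
    by have := ltn_ord r; rewrite [X in (_ < X)%N]muln0.
  rewrite [RHS]big1 => [|m _]; last by rewrite det_mx00.
  rewrite /determinant (big_pred1 1%g) => [|s].
    by rewrite odd_perm1 expr0 mul1r big1 // => r; case: (no_row r).
  by apply/esym/eqP/permP=> r; case: (no_row r).
elim: k B => [|k IHk] B.
  by rewrite big_ord0; exact: det_mx00.
(* [k.+1 * n] is convertible to [n + k * n], so M can be cut into blocks. *)
rewrite big_ord_recl -(IHk (fun m => B m.+1)).
set M := (M in \det M = _); rewrite -(@submxK _ n (k * n) n (k * n) M).
have -> : @dlsubmx _ n (k * n) n (k * n) M = 0.
  apply/matrixP=> i j; rewrite !mxE /= divnDl // divnn n_gt0.
  by rewrite (divn_small (ltn_ord j)).
rewrite det_ublock; congr (_ * _); congr (\det _); apply/matrixP=> i j.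
  by rewrite !mxE /= !divn_small ?eqxx // !modn_small.
by rewrite !mxE /= !divnDl // divnn n_gt0 !add1n eqSS !modnDl.
Qed.

Section Colouring.
Variables (C : fieldType) (k : nat) (S : rational_curve C k).
Implicit Types (c : pairs k -> 'I_k) (L : {set pairs k}).

Lemma lex_row_bij : bijective (@lex_row k).
Proof.
by apply: inj_card_bij (@lex_row_inj k) _; rewrite card_pairs card_ord.
Qed.

Lemma card_src (m : 'I_k) : #|[set p : pairs k | src p == m]| = k.-1.
Proof.
pose f (j : 'I_k.-1) : pairs k := exist _ (m, lift m j) (neq_lift m j).
have f_inj : injective f.
  by move=> i j [/eqP]; rewrite eqn_leq !leq_bump2 -eqn_leq => /eqP/val_inj.
rewrite -[RHS]card_ord -(card_imset _ f_inj); congr #|pred_of_set _|.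
apply/setP=> -[[i j] /= ij]; rewrite inE /src /=.
apply/eqP/imsetP => [im|[l _ [-> _]]] //.
subst i; have [l jE _] := unlift_some ij.
by exists l => //; apply: val_inj; rewrite /= -jE.
Qed.

Lemma card_tgt (m : 'I_k) : #|[set p : pairs k | tgt p == m]| = k.-1.
Proof.
have swapP (p : pairs k) : tgt p != src p.
  by rewrite eq_sym; exact: (valP p).
pose swap (p : pairs k) : pairs k := exist _ (tgt p, src p) (swapP p).
have swapK : involutive swap by move=> [[i j] ij]; exact: val_inj.
rewrite -(card_src m) -(card_preimset _ (inv_inj swapK)).
by congr #|pred_of_set _|; apply/setP=> p; rewrite !inE.
Qed.

(** The component whose columns support row [p] once [L] has selected its [lam] or [mu] summand. *)
Definition colour L (p : pairs k) : 'I_k := if p \in L then src p else tgt p.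

Lemma block_colour L m : block L m = [set p | colour L p == m].
Proof.
by apply/setP=> p; rewrite !inE /colour; case: (p \in L); rewrite ?orbF.
Qed.

(** With [T] the pairs of target [m], the block is the disjoint union of the pairs of [L] of source
    [m] and [T :\: L]. As [T] has k - 1 elements, so does the block exactly when its first part has
    as many elements as [L :&: T]. *)
Lemma regular_block L : regular L = [forall m, #|block L m| == k.-1].
Proof.
apply: eq_forallb => m; rewrite -(card_tgt m).
set T := [set p | tgt p == m].
have -> : [set p in L | tgt p == m] = L :&: T by apply/setP=> p; rewrite !inE.
rewrite /block cardsU [X in (_ + _ - X)%N](_ : _ = 0%N) ?subn0; last first.
  apply/eqP; rewrite cards_eq0; apply/eqP/setP=> p; rewrite !inE.
  by case: (p \in L); rewrite /= ?andbF.
have -> : [set p in ~: L | tgt p == m] = T :\: L.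
  by apply/setP=> p; rewrite !inE andbC.
by rewrite -[#|T|](cardsID L) [L :&: T]setIC eqn_add2r.
Qed.

Definition colour_mx c : 'M[C]_(k * k.-1) :=
  \matrix_(r, j) if c (lex_row r) == (lex_col j).1
                 then anode S (lex_row r) ^+ (lex_col j).2 else 0.

(* A nonzero term of the Leibniz formula matches the rows of each colour with
   the k - 1 columns of that colour. *)
Lemma det_colour_mx_eq0 c m :
  #|[set p | c p == m]| != k.-1 -> \det (colour_mx c) = 0.
Proof.
move=> cm; apply: big1 => s _.
case: (pickP (fun r => c (lex_row r) != (lex_col (s r)).1)) => [r rP|sP].
  by rewrite (bigD1 r) //= mxE (negPf rP) mul0r mulr0.
(* [src (lex_row r)] is [(lex_col r).1] by definition, so [card_src] also counts the columns of
   colour [m]. *)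
case/eqP: cm; rewrite -(card_src m).
rewrite -(on_card_preimset (f := @lex_row k));
  last exact: onW_bij lex_row_bij.
rewrite -[RHS](on_card_preimset (f := @lex_row k));
  last exact: onW_bij lex_row_bij.
rewrite -[RHS](card_preimset _ (@perm_inj _ s)).
congr #|pred_of_set _|; apply/setP=> r; rewrite !inE.
by have /negbFE/eqP -> := sP r.
Qed.

Section Ordered.
Variables (c : pairs k -> 'I_k) (o : 'I_k -> seq (pairs k)).
Hypothesis o_mem : forall m p, (p \in o m) = (c p == m).
Hypothesis o_size : forall m, size (o m) = k.-1.

Let s := flatten [seq o m | m <- enum 'I_k].

Lemma size_flatten_ordering : size s = (k * k.-1)%N.
Proof.
rewrite size_flatten /shape -map_comp sumnE big_map big_enum /=.
by rewrite (eq_bigr (fun=> k.-1)) // sum_nat_const card_ord.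
Qed.

(** Every pair occurs in [s], whose length is the number of pairs, so none occurs twice. *)
Lemma perm_flatten_ordering : perm_eq s (enum {: pairs k}).
Proof.
have mem_s p : p \in s.
  apply/flattenP; exists (o (c p)); last by rewrite o_mem.
  by apply: map_f; rewrite mem_enum.
have us : uniq s.
  apply: (@leq_size_uniq _ (enum {: pairs k})); rewrite ?enum_uniq //.
  by rewrite size_flatten_ordering -card_pairs cardE.
by apply: uniq_perm; rewrite ?enum_uniq // => p; rewrite mem_enum mem_s.
Qed.

Lemma nth_flatten_ordering p0 (m : 'I_k) j : (j < k.-1)%N ->
  nth p0 s (m * k.-1 + j) = nth p0 (o m) j.
Proof.
move=> jk; suff nthP (t : seq 'I_k) i : (i < size t)%N ->
    nth p0 (flatten (map o t)) (i * k.-1 + j) = nth p0 (o (nth m t i)) j.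
  by rewrite nthP ?size_enum_ord // nth_ord_enum.
elim: t i => // a t IHt [|i] it /=; rewrite nth_cat o_size.
  by rewrite add0n jk.
by rewrite mulSn -addnA ltnNge leq_addr /= addKn IHt.
Qed.

Lemma det_colour_mx : \det (colour_mx c) = theta_coef S o.
Proof.
have [g lexK gK] := lex_row_bij.
(* [f r] is the lexicographic position of the r-th element of [s]. *)
pose f r := g (list_perm s (lex_row r)).
have f_inj : injective f.
  by move=> r r' /(can_inj gK)/perm_inj/lex_row_inj.
have sgnE : odd_perm (perm f_inj) = odd_perm (list_perm s).
  by apply: (odd_perm_conj lex_row_bij) => r; rewrite permE gK.
(* The sign is inserted twice: one copy is that of [theta_coef], the other becomes the determinant
   of the row permutation. *)
rewrite /theta_coef -/s -sgnE -[LHS](signrMK (perm f_inj)).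
rewrite -[X in _ * (X * _)]det_perm -det_mulmx -row_permE; congr (_ * _).
pose B m i j : C :=
  (map (anode S) (nth [::] [seq o m | m <- enum 'I_k] m))`_i ^+ j.
have oE (m : 'I_k) : nth [::] [seq o m | m <- enum 'I_k] m = o m.
  by rewrite (nth_map m) ?size_enum_ord // nth_ord_enum.
transitivity (\det (\matrix_(r < k * k.-1, j < k * k.-1)
    if (r %/ k.-1 == j %/ k.-1)%N
    then B (r %/ k.-1)%N (r %% k.-1)%N (j %% k.-1)%N else 0)); last first.
  rewrite det_block_diag; apply: eq_bigr => m _; congr (\det _).
  by apply/matrixP=> i j; rewrite !mxE /B oE.
congr (\det _); apply/matrixP=> r j; rewrite !mxE permE gK.
have [m [i [rE mE iE]]] : exists (m : 'I_k) (i : 'I_k.-1),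
    [/\ (r : nat) = (m * k.-1 + i)%N, (r %/ k.-1)%N = m & (r %% k.-1)%N = i].
  by exists (lex_col r).1, (lex_col r).2; split=> //; exact: divn_eq.
rewrite list_permE ?perm_flatten_ordering // mE iE [X in nth _ _ X]rE.
rewrite nth_flatten_ordering //.
have io : (i < size (o m))%N by rewrite o_size.
have /eqP -> : c (nth (lex_row r) (o m) i) == m by rewrite -o_mem mem_nth.
by rewrite /B oE (nth_map (lex_row r)).
Qed.

End Ordered.

Lemma ext_theta_colour (lam mu : pairs k -> C) :
  ext_theta S lam mu = \sum_(L : {set pairs k})
    \prod_p (if p \in L then lam p else mu p) * \det (colour_mx (colour L)).
Proof.
have [g lexK gK] := lex_row_bij.
pose scaled (d : pairs k -> C) (e : pairs k -> 'I_k) : 'M[C]_(k * k.-1) :=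
  \matrix_(r, j) (d (lex_row r) * colour_mx e r j).
(* Since [src p != tgt p], the two summands never meet in one entry, in agreement with the nested
   tests in [Xi]. *)
have -> : ext_theta S lam mu = \det (scaled lam (@src k) + scaled mu (@tgt k)).
  congr (\det _); apply/matrixP=> r j; rewrite !mxE.
  case: (lex_col j) => m n /=; rewrite ![m == _]eq_sym.
  case: eqP => [<-|_]; last by case: eqP; rewrite mulr0 add0r ?mulr0.
  by rewrite eq_sym (negPf (valP (lex_row r))) mulr0 addr0.
rewrite det_addmx.
rewrite (reindex (fun L : {set pairs k} => @lex_row k @^-1: L)) /=; last first.
  exists (fun M : {set 'I_(k * k.-1)} => g @^-1: M) => L _;
    by apply/setP=> x; rewrite !inE ?gK ?lexK.
apply: eq_bigr => L _.
rewrite (reindex (@lex_row k)) /=;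
  last exact: onW_bij lex_row_bij.
rewrite -det_scale_rows.
congr (\det _); apply/matrixP=> r j; rewrite !mxE inE /colour.
by case: ifP.
Qed.

End Colouring.

Theorem theorem3p1 (R : realType) (k : nat) (hk : (2 <= k)%N)
    (S : rational_curve R[i] k)
    (ord : {set pairs k} -> 'I_k -> seq (pairs k))
    (hord : forall L : {set pairs k}, regular L ->
      forall m : 'I_k, is_ordering (block L m) (ord L m))
    (lam mu : pairs k -> R[i])
    (hlam : forall p, lam p != 0) (hmu : forall p, mu p != 0) :
  ext_theta S lam mu =
  \sum_(L : {set pairs k} | regular L)
    theta_coef S (ord L) *
    \prod_(p in L) lam p * \prod_(p | p \notin L) mu p.
Proof.
rewrite ext_theta_colour (bigID (@regular k)) /=.
rewrite [X in _ + X]big1 ?addr0; last first.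
  move=> L; rewrite regular_block negb_forall => /existsP[m].
  by rewrite block_colour => /(det_colour_mx_eq0 S) ->; rewrite mulr0.
apply: eq_bigr => L regL.
rewrite -(det_colour_mx S (c := colour L)) => [|m p|m].
- rewrite mulrC -mulrA (bigID (fun p => p \in L)) /=; congr (_ * (_ * _)).
    by apply: eq_bigr => p ->.
  by apply: eq_bigr => p /negPf ->.
- by case: (hord L regL m) => _ ->; rewrite block_colour inE.
(* [ord L m] has no repetition, so its length is the cardinality of the block. *)
- case: (hord L regL m) => /card_uniqP <- /eq_card ->.
  by move: regL; rewrite regular_block => /forallP/(_ m)/eqP.
Qed.
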